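(* Let $E$ be a locally compact separable metric space, $Q(x,dy)$ a probability kernel on $(E,\mathcal{B}(E))$ with $Q(x,\{x\})=0$ for all $x\in E$, and $m_0$ a $\sigma$-finite measure fully supported on $E$ with $Q(x,dy)m_0(dx)=Q(y,dx)m_0(dy)$. Let $\lambda$ be a bounded Borel function on $E$ with $0<\lambda(x)<\infty$, and suppose $m(dx):=\lambda(x)^{-1}m_0(dx)$ is a Radon measure. Let $(\mathcal{E},\mathcal{F})$ be the Dirichlet form on $L^2(E,m)$ given by $\mathcal{F}=L^2(E,m)$ and $$\mathcal{E}(u,v)=\frac12\int_{E\times E}(u(x)-u(y))(v(x)-v(y))Q(x,dy)\lambda(x)m(dx)+\int_E u(x)v(x)(1-Q(x,E))\lambda(x)m(dx),$$ which is a regular Dirichlet form (associated with the pure jump step process with road map $Q$ and speed function $\lambda$). If $(\mathcal{E}',\mathcal{F}')$ is a regular Dirichlet subspace of $(\mathcal{E},\mathcal{F})$, then $(\mathcal{E}',\mathcal{F}')=(\mathcal{E},\mathcal{F})$.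
   Context: A regular Dirichlet subspace of a regular Dirichlet form $(\mathcal{E},\mathcal{F})$ on $L^2(E,m)$ is a regular Dirichlet form $(\mathcal{E}',\mathcal{F}')$ on $L^2(E,m)$ with $\mathcal{F}'\subset\mathcal{F}$ and $\mathcal{E}'(u,v)=\mathcal{E}(u,v)$ for all $u,v\in\mathcal{F}'$. *)

(* Defs.v *)
From HB Require Import structures.
From mathcomp Require Import all_boot all_order all_algebra.
From mathcomp Require Import all_classical all_reals all_analysis.

Set Implicit Arguments.
Unset Strict Implicit.
Unset Printing Implicit Defensive.

Import Order.TTheory GRing.Theory Num.Theory.
Import numFieldNormedType.Exports.

Local Open Scope classical_set_scope.
Local Open Scope ring_scope.

(* [borelE x0] is the carrier of the metric space E, equipped with the Borel
   sigma-algebra generated by the open sets of E (x0 only witnesses that E is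
   nonempty, as required by MathComp-Analysis' measurable types). *)
Definition borelE (R : realType) (E : metricType R) (x0 : E) : Type := E.

Section borelE_instance.
Variables (R : realType) (E : metricType R) (x0 : E).

Lemma borelE_sigmaC (A : set E) :
  <<s @open E >> A -> <<s @open E >> (~` A).
Proof. by move=> sGA; rewrite -setTD; exact: sigma_algebraCD. Qed.

HB.instance Definition _ := Choice.on (borelE x0).
HB.instance Definition _ := isPointed.Build (borelE x0) x0.
HB.instance Definition _ := @isMeasurable.Build (sigma_display (@open E))
  (borelE x0) <<s @open E >> (@sigma_algebra0 _ setT (@open E))
  (@borelE_sigmaC) (@sigma_algebra_bigcup _ setT (@open E)).
End borelE_instance.

Definition separable_space (T : topologicalType) : Prop :=
  exists D : set T, countable D /\ dense D.

Definition Cc (R : realType) (E : metricType R) (u : E -> R) : Prop :=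
  continuous u /\ exists K : set E, compact K /\ (forall x, ~ K x -> u x = 0).

Section L2.
Variables (R : realType) (E : metricType R) (x0 : E).
Local Notation T := (borelE x0).
Variable m : {measure set T -> \bar R}.

Definition L2 (u : T -> R) : Prop :=
  measurable_fun setT u /\ (\int[m]_x ((u x) ^+ 2)%:E < +oo)%E.

Definition ae_eq_fun (u v : T -> R) : Prop := {ae m, forall x, u x = v x}.

Definition L2inner (u v : T -> R) : R := fine (\int[m]_x (u x * v x)%:E).

Definition fsub (u v : T -> R) : T -> R := fun x => u x - v x.

(* Elements of L^2 are represented by their measurable
   representatives; F is closed under m-a.e. equality and Ef does not depend
   on the choice of representatives. *)
Definition dirichlet_form (F : set (T -> R)) (Ef : (T -> R) -> (T -> R) -> R)
  : Prop :=
  let E1 u v := Ef u v + L2inner u v in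
  (forall u, F u -> L2 u) /\
  (forall u v, F u -> L2 v -> ae_eq_fun u v -> F v) /\
  F (fun _ => 0) /\
  (forall u v, F u -> F v -> F (fun x => u x + v x)) /\
  (forall (a : R) u, F u -> F (fun x => a * u x)) /\
  (forall f, L2 f -> forall eps : R, 0 < eps ->
     exists2 u, F u & L2inner (fsub f u) (fsub f u) < eps) /\
  (forall u u' v, F u -> F u' -> F v -> ae_eq_fun u u' -> Ef u v = Ef u' v) /\
  (forall u v, F u -> F v -> Ef u v = Ef v u) /\
  (forall u w v, F u -> F w -> F v ->
     Ef (fun x => u x + w x) v = Ef u v + Ef w v) /\
  (forall (a : R) u v, F u -> F v -> Ef (fun x => a * u x) v = a * Ef u v) /\
  (forall u, F u -> 0 <= Ef u u) /\
  (forall un : nat -> T -> R, (forall n, F (un n)) ->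
     (forall eps : R, 0 < eps -> exists N, forall n k, (N <= n)%N -> (N <= k)%N ->
        E1 (fsub (un n) (un k)) (fsub (un n) (un k)) < eps) ->
     exists2 u, F u &
       (fun n => E1 (fsub (un n) u) (fsub (un n) u)) @ \oo --> (0 : R)) /\
  (forall u, F u ->
     let v := fun x => Order.min (Order.max (u x) 0) 1 in
     F v /\ Ef v v <= Ef u u).

Definition regular_form (F : set (T -> R)) (Ef : (T -> R) -> (T -> R) -> R)
  : Prop :=
  let E1 u v := Ef u v + L2inner u v in
  (forall u, F u -> forall eps : R, 0 < eps ->
     exists g : T -> R, [/\ Cc (g : E -> R), F g &
       E1 (fsub u g) (fsub u g) < eps]) /\
  (forall f : T -> R, Cc (f : E -> R) -> forall eps : R, 0 < eps ->
     exists g : T -> R, [/\ Cc (g : E -> R), F g &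
       forall x, `|f x - g x| < eps]).

Definition regular_dirichlet_form F Ef :=
  dirichlet_form F Ef /\ regular_form F Ef.

Definition regular_dirichlet_subspace (F' : set (T -> R)) Ef'
    (F : set (T -> R)) (Ef : (T -> R) -> (T -> R) -> R) : Prop :=
  regular_dirichlet_form F' Ef' /\ F' `<=` F /\
  (forall u v, F' u -> F' v -> Ef' u v = Ef u v).

End L2.

Section jump_form.
Variables (R : realType) (E : metricType R) (x0 : E).
Local Notation T := (borelE x0).

Definition jump_form (Q : R.-pker T ~> T) (lam : T -> R)
  (m : {measure set T -> \bar R}) (u v : T -> R) : R :=
  fine ((2^-1)%:E *
          \int[m]_x ((lam x)%:E *
                       \int[Q x]_y ((u x - u y) * (v x - v y))%:E)
        + \int[m]_x ((u x * v x * (1 - fine (Q x setT)) * lam x)%:E))%E.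

End jump_form.

(* Main.v *)
Require Import Defs.
From HB Require Import structures.
From mathcomp Require Import all_boot all_order all_algebra.
From mathcomp Require Import all_classical all_reals all_analysis.
From mathcomp Require Import measurable_realfun.
From mathcomp Require Import ring lra.

Import Order.TTheory GRing.Theory Num.Theory.
Import numFieldNormedType.Exports.

Local Open Scope classical_set_scope.
Local Open Scope ring_scope.

(* Since Q is a probability kernel reversible with respect to m0 and
   m = lambda^-1 m0 with lambda <= M, the jump form is bounded on L^2(m):
   E(u, u) <= 2 M |u|^2, because (u x - u y)^2 <= 2 u(x)^2 + 2 u(y)^2 and
   reversibility turns the integral of u(y)^2 against Q(x, dy) lambda(x) m(dx)
   into the integral of u^2 against m0 = lambda m.  Hence on a Dirichlet
   subspace F' the E_1-norm is equivalent to the L^2-norm.  F' is dense in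
   L^2 and E_1-complete, so it is L^2-closed, and therefore F' = L^2 = F. *)

Section integral_mixture.
Local Open Scope ereal_scope.
Context {d d'} {X : measurableType d} {Y : measurableType d'} {R : realType}.
Variables (mu : {measure set X -> \bar R}) (nu : {measure set Y -> \bar R})
  (l : X -> {measure set Y -> \bar R}).
Hypotheses (ml : forall U, measurable U -> measurable_fun [set: X] (fun x => l x U))
  (nuE : forall A, measurable A -> \int[mu]_x l x A = nu A).

Let integral_mixture_indic A : measurable A ->
  \int[mu]_x (\int[l x]_z (\1_A z)%:E) = \int[nu]_z (\1_A z)%:E.
Proof.
move=> mA; rewrite integral_indic// setIT -nuE//.
by apply: eq_integral => y _; rewrite integral_indic// setIT.
Qed.

Import HBNNSimple.

Let integral_mixture_nnsfun (f : {nnsfun Y >-> R}) :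
  \int[mu]_x (\int[l x]_z (f z)%:E) = \int[nu]_z (f z)%:E.
Proof.
under [in RHS]eq_integral do rewrite fimfunE -fsumEFin//.
rewrite [RHS]ge0_integral_fsum//; last 2 first.
  - by move=> r; exact/measurable_EFinP/measurableT_comp.
  - by move=> r z _; rewrite EFinM nnfun_muleindic_ge0.
under [in LHS]eq_integral.
  move=> y _.
  under eq_integral.
    by move=> z _; rewrite fimfunE -fsumEFin//; over.
  rewrite /= ge0_integral_fsum//; last 2 first.
    - by move=> r; exact/measurable_EFinP/measurableT_comp.
    - by move=> r z _; rewrite EFinM nnfun_muleindic_ge0.
  under eq_fsbigr.
    move=> r _.
    rewrite (integralZl_indic _ (fun r => f @^-1` [set r]))//; last first.
      by move=> r0; rewrite preimage_nnfun0.
    rewrite integral_indic// setIT.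
    over.
  over.
rewrite /= ge0_integral_fsum//; last 2 first.
  - by move=> r; apply: measurable_funeM; exact: ml.
  - move=> n y _.
    have := mulemu_ge0 (fun n => f @^-1` [set n]).
    by apply; exact: preimage_nnfun0.
apply: eq_fsbigr => r _.
rewrite (integralZl_indic _ (fun r => f @^-1` [set r]))//; last first.
  exact: preimage_nnfun0.
rewrite /= -integral_mixture_indic//.
have [r0|r0] := leP 0%R r.
  rewrite ge0_integralZl//; last exact: ml.
  by congr (_ * _); apply: eq_integral => x _; rewrite integral_indic// setIT.
rewrite preimage_nnfun0// integral0_eq; last by move=> x _; rewrite measure0 mule0.
rewrite integral0_eq ?mule0// => x _.
by rewrite integral0_eq// => z _; rewrite indic0.
Qed.

Lemma ge0_integral_mixture f : (forall z, 0 <= f z) ->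
  measurable_fun [set: Y] f ->
  \int[mu]_x (\int[l x]_z f z) = \int[nu]_z f z.
Proof.
move=> f0 mf; pose f_ := nnsfun_approx measurableT mf.
have mf_ n : measurable_fun [set: Y] (fun z => (f_ n z)%:E).
  exact/measurable_EFinP.
have f_ge0 n z : 0 <= (f_ n z)%:E by rewrite lee_fin.
have nd_f_ z : {homo (fun n => (f_ n z)%:E) : a b / (a <= b)%N >-> a <= b}.
  by move=> a b ab; rewrite lee_fin; exact/lefP/nd_nnsfun_approx.
have f_E (k : {measure set Y -> \bar R}) :
    \int[k]_z f z = limn (fun n => \int[k]_z (f_ n z)%:E).
  rewrite -monotone_convergence//.
  by apply: eq_integral => z _; apply/esym/cvg_lim => //; exact: cvg_nnsfun_approx.
under eq_integral do rewrite f_E.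
rewrite monotone_convergence//; last 3 first.
- by move=> n; exact: measurable_fun_integral_kernel.
- by move=> n y _; exact: integral_ge0.
- move=> y _ a b ab; apply: ge0_le_integral => // z _.
  exact: nd_f_.
by rewrite f_E; under eq_fun do rewrite integral_mixture_nnsfun.
Qed.

End integral_mixture.

Section integral_density.
Local Open Scope ereal_scope.
Context {d} {T : measurableType d} {R : realType}.
Variables (mu nu : {measure set T -> \bar R}) (h : T -> R).
Hypotheses (h_ge0 : forall x, (0 <= h x)%R) (mh : measurable_fun [set: T] h)
  (nuE : forall A, measurable A -> nu A = \int[mu]_(x in A) (h x)%:E).

(* nu is the mixture of the weighted point masses h x * \d_x under mu. *)
Let hdirac x : {measure set T -> \bar R} := mscale (NngNum (h_ge0 x)) \d_x.

Let hdiracE x U : hdirac x U = (h x * \1_U x)%:E.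
Proof.
by change ((h x)%:E * \d_x U = (h x * \1_U x)%:E); rewrite diracE EFinM.
Qed.

Lemma ge0_integral_density f : (forall x, 0 <= f x) ->
  measurable_fun [set: T] f ->
  \int[nu]_x f x = \int[mu]_x ((h x)%:E * f x).
Proof.
move=> f0 mf; rewrite -(ge0_integral_mixture mu nu hdirac) //.
- apply: eq_integral => x _.
  by rewrite ge0_integral_mscale//= integral_dirac// diracT mul1e.
- move=> U mU; under eq_fun do rewrite hdiracE.
  exact/measurable_EFinP/measurable_funM.
- move=> A mA; rewrite nuE// [RHS]integral_mkcond; apply: eq_integral => x _.
  by rewrite hdiracE patchE indicE; case: ifPn; rewrite ?mulr1 ?mulr0.
Qed.

End integral_density.

Lemma ge0_integral_reversible {d} {T : measurableType d} {R : realType}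
    (Q : R.-pker T ~> T) (mu : {measure set T -> \bar R})
    (Q_rev : forall A B, measurable A -> measurable B ->
      (\int[mu]_(x in A) Q x B = \int[mu]_(y in B) Q y A)%E)
    (f : T -> \bar R) :
  (forall x, 0 <= f x)%E -> measurable_fun [set: T] f ->
  (\int[mu]_x \int[Q x]_y f y = \int[mu]_x f x)%E.
Proof.
move=> f0 mf; apply: ge0_integral_mixture => // [U mU|A mA].
  exact: measurable_kernel.
rewrite Q_rev// (eq_integral (cst 1%E)) => [|y _]; last by rewrite prob_kernel.
by rewrite integral_cst// mul1e.
Qed.

Lemma integral_sqr_subr_le {d} {T : measurableType d} {R : realType}
    (mu : {measure set T -> \bar R}) {f g : T -> R} :
  measurable_fun [set: T] f -> measurable_fun [set: T] g ->
  (\int[mu]_x ((f x - g x) ^+ 2)%:E <=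
   2%:E * \int[mu]_x (f x ^+ 2)%:E + 2%:E * \int[mu]_x (g x ^+ 2)%:E)%E.
Proof.
move=> mf mg.
have msqr2 (k : T -> R) : measurable_fun [set: T] k ->
    measurable_fun [set: T] (fun x => (2 * k x ^+ 2)%:E).
  by move=> mk; exact/measurable_EFinP/measurable_funM/measurable_funX.
have sqr2_ge0 (k : T -> R) x : (0 <= (2 * k x ^+ 2)%:E)%E.
  by rewrite lee_fin mulr_ge0// sqr_ge0.
have integral_sqr2 (k : T -> R) : measurable_fun [set: T] k ->
    (\int[mu]_x (2 * k x ^+ 2)%:E = 2%:E * \int[mu]_x (k x ^+ 2)%:E)%E.
  move=> mk; rewrite -ge0_integralZl_EFin//.
  - by move=> x _; rewrite lee_fin sqr_ge0.
  - exact/measurable_EFinP/measurable_funX.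
rewrite -integral_sqr2// -integral_sqr2// -ge0_integralD//; [|exact: msqr2..].
apply: ge0_le_integral => //.
- by move=> x _; rewrite lee_fin sqr_ge0.
- exact/measurable_EFinP/measurable_funX/measurable_funB.
- exact: emeasurable_funD (msqr2 _ mf) (msqr2 _ mg).
- move=> x _; rewrite -EFinD lee_fin -subr_ge0.
  have -> : 2 * f x ^+ 2 + 2 * g x ^+ 2 - (f x - g x) ^+ 2 = (f x + g x) ^+ 2.
    by ring.
  exact: sqr_ge0.
Qed.

Lemma integral_prob_sqr_subr_le {d} {T : measurableType d} {R : realType}
    (P : {measure set T -> \bar R}) (a : R) {w : T -> R} :
  P [set: T] = 1%E -> measurable_fun [set: T] w ->
  (\int[P]_y ((a - w y) ^+ 2)%:E <=
   (2 * a ^+ 2)%:E + 2%:E * \int[P]_y ((w y) ^+ 2)%:E)%E.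
Proof.
move=> P1 mw; have := integral_sqr_subr_le P (measurable_cst a) mw.
by rewrite /= integral_cst// P1 mule1 EFinM.
Qed.

Lemma reversible_energy_le {d} {T : measurableType d} {R : realType}
    (Q : R.-pker T ~> T) (mu : {measure set T -> \bar R})
    (Q_rev : forall A B, measurable A -> measurable B ->
      (\int[mu]_(x in A) Q x B = \int[mu]_(y in B) Q y A)%E)
    {w : T -> R} : measurable_fun [set: T] w ->
  (\int[mu]_x \int[Q x]_y ((w x - w y) ^+ 2)%:E <=
   4%:E * \int[mu]_x ((w x) ^+ 2)%:E)%E.
Proof.
move=> mw.
have mw2 : measurable_fun [set: T] (fun x => ((w x) ^+ 2)%:E).
  exact/measurable_EFinP/measurable_funX.
have mw2' : measurable_fun [set: T] (fun x => (2 * (w x) ^+ 2)%:E).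
  exact/measurable_EFinP/measurable_funM/measurable_funX.
have Qw2_ge0 x : (0 <= \int[Q x]_y ((w y) ^+ 2)%:E)%E.
  by apply: integral_ge0 => y _; rewrite lee_fin sqr_ge0.
have mQw2 : measurable_fun [set: T]
    (fun x => \int[Q x]_y ((w y) ^+ 2)%:E)%E.
  apply: measurable_fun_integral_kernel => //; first exact: measurable_kernel.
  by move=> y; rewrite lee_fin sqr_ge0.
apply: (@le_trans _ _ (\int[mu]_x
    ((2 * (w x) ^+ 2)%:E + 2%:E * \int[Q x]_y ((w y) ^+ 2)%:E))%E).
  apply: ge0_le_integral => //.
  - by move=> x _; apply: integral_ge0 => y _; rewrite lee_fin sqr_ge0.
  - apply: (measurable_fun_integral_finite_kernel
      (fun p : T * T => ((w p.1 - w p.2) ^+ 2)%:E) Q).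
      by move=> p; rewrite lee_fin sqr_ge0.
    apply/measurable_EFinP/measurable_funX.
    exact: measurable_funB (measurableT_comp mw measurable_fst)
                           (measurableT_comp mw measurable_snd).
  - exact: emeasurable_funD mw2' (emeasurable_funM _ mQw2).
  - move=> x _; apply: integral_prob_sqr_subr_le mw.
    exact: prob_kernel.
rewrite ge0_integralD//; last 3 first.
- by move=> x _; rewrite lee_fin mulr_ge0// sqr_ge0.
- by move=> x _; apply: mule_ge0.
- exact: emeasurable_funM.
under eq_integral do rewrite EFinM.
rewrite !ge0_integralZl_EFin//; last by move=> x _; rewrite lee_fin sqr_ge0.
rewrite ge0_integral_reversible//; last by move=> x; rewrite lee_fin sqr_ge0.
by rewrite -ge0_muleDl// -EFinD -natrD.
Qed.

Section jump_energy.
Local Open Scope ereal_scope.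
Context {d} {T : measurableType d} {R : realType}.
Context {Q : R.-pker T ~> T} {m0 m : {measure set T -> \bar R}}
  {lam : T -> R} {M : R}.
Hypotheses (lam_meas : measurable_fun [set: T] lam)
  (lam_pos : forall x, (0 < lam x)%R) (lam_le : forall x, (lam x <= M)%R)
  (m_def : forall A, measurable A -> m A = \int[m0]_(x in A) ((lam x)^-1)%:E)
  (Q_rev : forall A B, measurable A -> measurable B ->
     \int[m0]_(x in A) Q x B = \int[m0]_(y in B) Q y A).

Let inv_lam_ge0 x : (0 <= (lam x)^-1)%R.
Proof. by rewrite invr_ge0 ltW. Qed.

Let measurable_inv_lam : measurable_fun [set: T] (fun x => (lam x)^-1)%R.
Proof.
rewrite (_ : (fun x => _) = (@powR R ^~ (-1)%R) \o lam).
  exact: measurableT_comp (measurable_powR _) lam_meas.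
by apply/funext => x /=; rewrite powR_inv1// ltW.
Qed.

Lemma ge0_integral_speedM f : (forall x, 0 <= f x) ->
  measurable_fun [set: T] f ->
  \int[m]_x ((lam x)%:E * f x) = \int[m0]_x f x.
Proof.
move=> f0 mf.
rewrite (ge0_integral_density m0 m _ inv_lam_ge0 measurable_inv_lam m_def);
  last 2 first.
- by move=> x; rewrite mule_ge0// lee_fin ltW.
- by apply: emeasurable_funM => //; exact/measurable_EFinP.
apply: eq_integral => x _.
by rewrite muleA -EFinM mulVf ?mul1e// gt_eqF.
Qed.

Lemma jump_energy_le {w : T -> R} : measurable_fun [set: T] w ->
  \int[m]_x ((lam x)%:E * \int[Q x]_y ((w x - w y) ^+ 2)%:E)
  <= (4 * M)%:E * \int[m]_x ((w x) ^+ 2)%:E.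
Proof.
move=> mw.
have M_ge0 : (0 <= M)%R := le_trans (ltW (lam_pos point)) (lam_le point).
have mw2 : measurable_fun [set: T] (fun x => ((w x) ^+ 2)%:E).
  exact/measurable_EFinP/measurable_funX.
have w2_ge0 x : 0 <= ((w x) ^+ 2)%:E by rewrite lee_fin sqr_ge0.
rewrite ge0_integral_speedM//; first last.
- apply: (measurable_fun_integral_finite_kernel
    (fun p : T * T => ((w p.1 - w p.2) ^+ 2)%:E) Q).
    by move=> p; rewrite lee_fin sqr_ge0.
  apply/measurable_EFinP/measurable_funX.
  exact: measurable_funB (measurableT_comp mw measurable_fst)
                         (measurableT_comp mw measurable_snd).
- by move=> x; apply: integral_ge0 => y _; rewrite lee_fin sqr_ge0.
apply: le_trans (reversible_energy_le _ _ Q_rev mw) _.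
rewrite EFinM -muleA; apply: lee_wpmul2l => //.
rewrite -ge0_integral_speedM// -ge0_integralZl_EFin//.
apply: ge0_le_integral => //.
- by move=> x _; rewrite mule_ge0// lee_fin ltW.
- by apply: emeasurable_funM => //; exact/measurable_EFinP.
- exact: emeasurable_funM (measurable_cst _) mw2.
- by move=> x _; rewrite lee_wpmul2r// lee_fin.
Qed.

End jump_energy.

Section L2_sqnorm.
Local Open Scope ereal_scope.
Context {R : realType} {E : metricType R} {x0 : E}.
Local Notation T := (borelE x0).
Variable m : {measure set T -> \bar R}.

Definition L2sqnorm (u : T -> R) := \int[m]_x ((u x) ^+ 2)%:E.

Lemma L2sqnorm_ge0 u : 0 <= L2sqnorm u.
Proof. by apply: integral_ge0 => x _; rewrite lee_fin sqr_ge0. Qed.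

Lemma L2_fin_num {u} : L2 m u -> L2sqnorm u \is a fin_num.
Proof. by case=> _ u_fin; rewrite ge0_fin_numE// L2sqnorm_ge0. Qed.

Lemma L2innerE u : L2inner m u u = fine (L2sqnorm u).
Proof.
by rewrite /L2inner /L2sqnorm; congr fine; apply: eq_integral => x _; rewrite expr2.
Qed.

Lemma L2inner_ge0 u : (0 <= L2inner m u u)%R.
Proof. by rewrite L2innerE fine_ge0// L2sqnorm_ge0. Qed.

Lemma L2sqnorm_fsubC u v : L2sqnorm (fsub u v) = L2sqnorm (fsub v u).
Proof.
by apply: eq_integral => x _; rewrite /fsub -sqrrN opprB.
Qed.

Lemma L2inner_fsubC u v :
  L2inner m (fsub u v) (fsub u v) = L2inner m (fsub v u) (fsub v u).
Proof. by rewrite !L2innerE L2sqnorm_fsubC. Qed.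

Lemma L2_fsub {u v} : L2 m u -> L2 m v -> L2 m (fsub u v).
Proof.
move=> [mu u_fin] [mv v_fin]; split; first exact: measurable_funB.
apply: le_lt_trans (integral_sqr_subr_le m mu mv) _.
by rewrite lte_add_pinfty// lte_mul_pinfty.
Qed.

Lemma L2inner_fsub_le {u v w} : L2 m u -> L2 m v -> L2 m w ->
  (L2inner m (fsub u w) (fsub u w) <=
   2 * L2inner m (fsub u v) (fsub u v) + 2 * L2inner m (fsub v w) (fsub v w))%R.
Proof.
move=> Lu Lv Lw.
have [[muv _] [mwv _]] := (L2_fsub Lu Lv, L2_fsub Lw Lv).
have fin_uw := L2_fin_num (L2_fsub Lu Lw).
have fin_uv := L2_fin_num (L2_fsub Lu Lv).
have fin_vw := L2_fin_num (L2_fsub Lv Lw).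
rewrite !L2innerE -lee_fin EFinD !EFinM !fineK//.
have -> : L2sqnorm (fsub u w) = \int[m]_x ((fsub u v x - fsub w v x) ^+ 2)%:E.
  by apply: eq_integral => x _; rewrite /fsub opprB addrA subrK.
by rewrite (L2sqnorm_fsubC v w); exact: integral_sqr_subr_le.
Qed.

Lemma L2inner_fsub_eq0 {u v} : L2 m (fsub u v) ->
  (L2inner m (fsub u v) (fsub u v) <= 0)%R -> ae_eq_fun m u v.
Proof.
move=> Luv le0.
have sqnorm0 : L2sqnorm (fsub u v) = 0.
  rewrite -(fineK (L2_fin_num Luv)); congr EFin; apply/eqP.
  by rewrite eq_le -L2innerE le0 L2inner_ge0.
have m_sqr : measurable_fun [set: T] (fun x => ((fsub u v x) ^+ 2)%:E).
  by case: Luv => muv _; exact/measurable_EFinP/measurable_funX.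
have := (ae_eq_integral_abs m measurableT m_sqr).1.
have -> : \int[m]_x `|((fsub u v x) ^+ 2)%:E| = L2sqnorm (fsub u v).
  by apply: eq_integral => x _; rewrite gee0_abs// lee_fin sqr_ge0.
move=> /(_ sqnorm0); apply: filterS => x /(_ I) /=.
by move=> [] /eqP; rewrite sqrf_eq0 subr_eq0 => /eqP.
Qed.

End L2_sqnorm.

Section jump_form_bound.
Context {R : realType} {E : metricType R} {x0 : E}.
Local Notation T := (borelE x0).
Context {Q : R.-pker T ~> T} {m0 m : {measure set T -> \bar R}}
  {lam : T -> R} {M : R}.
Hypotheses (lam_meas : measurable_fun [set: T] lam)
  (lam_pos : forall x, 0 < lam x) (lam_le : forall x, lam x <= M)
  (m_def : forall A, measurable A ->
     m A = (\int[m0]_(x in A) ((lam x)^-1)%:E)%E)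
  (Q_rev : forall A B, measurable A -> measurable B ->
     (\int[m0]_(x in A) Q x B = \int[m0]_(y in B) Q y A)%E).

Lemma jump_form_le {w : T -> R} : L2 m w ->
  jump_form Q lam m w w <= 2 * M * L2inner m w w.
Proof.
move=> Lw; rewrite /jump_form.
have -> : (\int[m]_x ((w x * w x * (1 - fine (Q x setT)) * lam x)%:E) = 0)%E.
  rewrite (eq_integral (fun=> 0%E)) ?integral0// => x _.
  by rewrite prob_kernel /= subrr mulr0 mul0r.
rewrite adde0 L2innerE.
have := jump_energy_le lam_meas lam_pos lam_le m_def Q_rev (proj1 Lw).
under eq_integral do under eq_integral do rewrite expr2.
rewrite -/(L2sqnorm m w); set I := (\int[m]_x _)%E => I_le.
have I_ge0 : (0 <= I)%E.
  apply: integral_ge0 => x _; apply: mule_ge0; first by rewrite lee_fin ltW.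
  by apply: integral_ge0 => y _; rewrite lee_fin -expr2 sqr_ge0.
have I_fin : I \is a fin_num.
  rewrite ge0_fin_numE//; apply: le_lt_trans I_le _.
  by rewrite -(fineK (L2_fin_num m Lw)) -EFinM ltry.
move: I_le; rewrite -(fineK (L2_fin_num m Lw)) -(fineK I_fin) -!EFinM lee_fin /=.
lra.
Qed.

End jump_form_bound.

Section bounded_dirichlet_form.
Context {R : realType} {E : metricType R} {x0 : E}.
Local Notation T := (borelE x0).
Context {m : {measure set T -> \bar R}} {F : set (T -> R)}
  {Ef : (T -> R) -> (T -> R) -> R} {C : R}.
Hypotheses (F_form : dirichlet_form m F Ef) (C_ge0 : 0 <= C)
  (Ef_le : forall u, F u -> Ef u u <= C * L2inner m u u).

Local Notation N u := (L2inner m u u).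
Local Notation E1 u := (Ef u u + L2inner m u u).

Let F_L2 {u} : F u -> L2 m u.
Proof. by case: F_form => F_L2 _; exact: F_L2. Qed.

Let F_ae u v : F u -> L2 m v -> ae_eq_fun m u v -> F v.
Proof. by case: F_form => _ [F_ae _]; exact: F_ae. Qed.

Let Ef_ge0 {u} : F u -> 0 <= Ef u u.
Proof.
by case: F_form => _ [_ [_ [_ [_ [_ [_ [_ [_ [_ [Ef_ge0 _]]]]]]]]]]; exact: Ef_ge0.
Qed.

Lemma dirichlet_form_fsub {u v} : F u -> F v -> F (fsub u v).
Proof.
case: F_form => _ [_ [_ [F_add [F_scale _]]]] Fu Fv.
have := F_add _ _ Fu (F_scale (-1) _ Fv).
by congr F; apply/funext => x; rewrite /fsub mulN1r.
Qed.

Lemma E1_le {u} : F u -> E1 u <= (C + 1) * N u.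
Proof. by move=> Fu; rewrite mulrDl mul1r lerD2r Ef_le. Qed.

Lemma E1_cauchy_approx {f} {un : nat -> T -> R} : L2 m f ->
  (forall n, F (un n)) -> (forall n, N (fsub (un n) f) < n.+1%:R^-1) ->
  forall eps, 0 < eps -> exists K, forall n k, (K <= n)%N -> (K <= k)%N ->
    E1 (fsub (un n) (un k)) < eps.
Proof.
move=> Lf Fun un_approx eps eps_gt0.
have K_gt0 : 0 < C + 1 := ltr_wpDl C_ge0 ltr01.
have e_gt0 : 0 < eps / (4 * (C + 1)) by rewrite divr_gt0// mulr_gt0.
have [K _ K_le] := near_infty_natSinv_lt (PosNum e_gt0).
exists K => n k Kn Kk.
apply: le_lt_trans (E1_le (dirichlet_form_fsub (Fun n) (Fun k))) _.
have := L2inner_fsub_le m (F_L2 (Fun n)) Lf (F_L2 (Fun k)).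
rewrite (L2inner_fsubC m f (un k)).
have := un_approx n; have := un_approx k.
have := K_le n Kn; have := K_le k Kk; rewrite /= => ek en.
set e := eps / _ in ek en; have epsE : (C + 1) * (4 * e) = eps.
  by rewrite /e; field; rewrite gt_eqF.
move: (N (fsub (un n) (un k))) (N (fsub (un n) f)) (N (fsub (un k) f)) => X A B.
move=> Bk An X_le.
have : (C + 1) * X <= (C + 1) * (2 * A + 2 * B) by rewrite ler_pM2l.
have : (C + 1) * A < (C + 1) * e by rewrite ltr_pM2l// (lt_trans An en).
have : (C + 1) * B < (C + 1) * e by rewrite ltr_pM2l// (lt_trans Bk ek).
lra.
Qed.

Lemma L2_sub_dirichlet_form : L2 m `<=` F.
Proof.
move=> f Lf.
case: F_form => _ [_ [_ [_ [_ [F_dense [_ [_ [_ [_ [_ [F_closed _]]]]]]]]]]].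
have approx n : exists u, F u /\ N (fsub u f) < n.+1%:R^-1.
  have [|u Fu fu_lt] := F_dense f Lf n.+1%:R^-1; first by rewrite invr_gt0.
  by exists u; rewrite L2inner_fsubC.
have [un /all_and2 [Fun un_approx]] := choice approx.
have [u Fu E1_cvg] := F_closed un Fun (E1_cauchy_approx Lf Fun un_approx).
have Lu := F_L2 Fu.
suff : N (fsub u f) <= 0.
  by move/(L2inner_fsub_eq0 m (L2_fsub m Lu Lf)); exact: F_ae.
pose r n := 2 * E1 (fsub (un n) u) + 2 * n.+1%:R^-1.
have r_cvg : r @ \oo --> 0.
  rewrite -[0]addr0 -[X in X + _](mulr0 2) -[X in _ + X](mulr0 2).
  by apply: cvgD; apply: cvgMl_tmp => //; exact: cvg_harmonic.
have le_r n : N (fsub u f) <= r n.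
  have := L2inner_fsub_le m Lu (F_L2 (Fun n)) Lf.
  rewrite (L2inner_fsubC m u (un n)).
  have := un_approx n; have := Ef_ge0 (dirichlet_form_fsub (Fun n) Fu).
  rewrite /r; move: (n.+1%:R^-1) => a; lra.
rewrite -(cvg_lim _ r_cvg) //; apply: limr_ge; first by apply/cvg_ex; exists 0.
exact: nearW.
Qed.

Lemma bounded_dirichlet_form_L2 : F = L2 m.
Proof. by apply/seteqP; split=> [u|]; [exact: F_L2 | exact: L2_sub_dirichlet_form]. Qed.

End bounded_dirichlet_form.

Theorem proposition4p1 (R : realType) (E : metricType R) (x0 : E)
  (E_lc : locally_compact [set: E]) (E_sep : separable_space E)
  (Q : R.-pker (borelE x0) ~> (borelE x0))
  (hQ : forall x : borelE x0, Q x [set x] = 0%E)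
  (m0 : {measure set (borelE x0) -> \bar R})
  (m0_sfin : sigma_finite setT m0)
  (m0_supp : forall U : set E, open U -> U !=set0 -> (0 < m0 U)%E)
  (m0_sym : forall A B : set (borelE x0), measurable A -> measurable B ->
     (\int[m0]_(x in A) Q x B = \int[m0]_(y in B) Q y A)%E)
  (lam : borelE x0 -> R) (lam_meas : measurable_fun setT lam)
  (lam_bd : exists M : R, forall x, lam x <= M)
  (lam_pos : forall x, 0 < lam x)
  (m : {measure set (borelE x0) -> \bar R})
  (m_def : forall A : set (borelE x0), measurable A ->
     m A = (\int[m0]_(x in A) ((lam x)^-1)%:E)%E)
  (m_radon : forall K : set E, compact K -> (m K < +oo)%E) :
  forall (F' : set (borelE x0 -> R)) (Ef' : (borelE x0 -> R) -> (borelE x0 -> R) -> R),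
    regular_dirichlet_subspace m F' Ef' (L2 m) (jump_form Q lam m) ->
    F' = L2 m /\
    (forall u v, L2 m u -> L2 m v -> Ef' u v = jump_form Q lam m u v).
Proof.
move=> F' Ef' [[F'_form _] [_ Ef'E]].
have [M lam_le] := lam_bd.
have M_ge0 : 0 <= M := le_trans (ltW (lam_pos x0)) (lam_le x0).
have Ef'_le u : F' u -> Ef' u u <= 2 * M * L2inner m u u.
  move=> F'u; rewrite Ef'E//.
  apply: (jump_form_le lam_meas lam_pos lam_le m_def m0_sym).
  by case: F'_form => F'_L2 _; exact: F'_L2.
have F'E := bounded_dirichlet_form_L2 F'_form (mulr_ge0 (ler0n _ 2) M_ge0) Ef'_le.
by split=> // u v Lu Lv; apply: Ef'E; rewrite F'E.
Qed.
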